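(* There exists a universal constant $c>0$ such that for every Boolean function $f:\Omega^\infty\to\Omega$ (not necessarily finitary) with $\delta:=\sup_iI_i(f)>0$, $$I(f)\ge c\,\mathrm{Var}(f)\log\frac1\delta.$$
   Context: Let $\Omega=\{-1,1\}$ and $\Omega^\infty=\{-1,1\}^{\mathbb N}$ with the uniform product probability measure; $\omega$ denotes a uniformly random element. A Boolean function is a measurable map $f:\Omega^\infty\to\Omega$. $\omega^{(k)}$ is $\omega$ with bit $k$ flipped; $I_k(f)=\mathbb P(f(\omega^{(k)})\ne f(\omega))$ and $I(f)=\sum_kI_k(f)$. $\log$ is the natural logarithm. *)

(* Defs.v *)
From HB Require Import structures.
From mathcomp Require Import all_boot all_order all_algebra.
From mathcomp Require Import all_classical all_reals all_analysis.
Set Implicit Arguments. Unset Strict Implicit. Unset Printing Implicit Defensive.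
Import Order.TTheory GRing.Theory Num.Theory.
Local Open Scope classical_set_scope.
Local Open Scope ring_scope.

(* The one-coordinate events {w | w i = b}; they generate the product
   sigma-algebra on {-1,1}^N (here {-1,1} is encoded by bool). *)
Definition coord_sets : set (set (nat -> bool)) :=
  [set A | exists (i : nat) (b : bool), A = [set w | w i = b]].

Definition Omega_inf := g_sigma_algebraType coord_sets.

(* P is the uniform product (fair coin) measure: every prefix cylinder
   {w | w_0 = b_0, ..., w_{n-1} = b_{n-1}} has probability 2^-n.  Prefix
   cylinders (with the empty set) form a pi-system generating the product
   sigma-algebra, so this determines P uniquely. *)
Definition uniform_product {R : realType} (P : probability Omega_inf R) : Prop :=
  forall (n : nat) (b : nat -> bool),
    P [set w : Omega_inf | forall i : nat, (i < n)%N -> w i = b i]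
      = (((1 / 2 : R) ^+ n)%:E)%E.

Definition flip (k : nat) (w : Omega_inf) : Omega_inf :=
  fun i => if i == k then ~~ w i else w i.

Definition influence {R : realType} (P : probability Omega_inf R)
    (f : Omega_inf -> R) (k : nat) : R :=
  fine (P [set w | f (flip k w) != f w]).

(* Main.v *)
Require Import Defs.
From HB Require Import structures.
From mathcomp Require Import all_boot all_order all_algebra ring lra.
From mathcomp Require Import all_classical all_reals all_analysis.
Import Order.TTheory GRing.Theory Num.Theory.
Local Open Scope classical_set_scope.
Local Open Scope ring_scope.
Set Implicit Arguments. Unset Strict Implicit. Unset Printing Implicit Defensive.

(** The Kahn-Kalai-Linial argument, applied to the conditional expectations
    g_n of f given the first n bits. The discrete derivative of g_n in
    direction k is bounded by 1 and its mean absolute value is at most I_k(f),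
    so by hypercontractivity
    \sum_(S \ni k) 3^(-|S|) g_n^(S)^2 <= I_k(f)^(3/2) <= sqrt delta I_k(f).
    A nonzero S satisfies 1 <= 3^d |S| 3^(-|S|) + |S| / d, whence
    Var(g_n) <= (3^d sqrt delta + 1 / d) I(f), and d of the order of
    ln (1 / delta) gives the bound for g_n. Finally Var(g_n) tends to Var(f)
    because measurable sets are approximated by finite unions of cylinders. *)

(** * Walsh analysis on the finite cube *)

Fixpoint bits n : seq (seq bool) :=
  if n is m.+1 then map (cons false) (bits m) ++ map (cons true) (bits m)
  else [:: [::]].

Lemma size_bits n s : s \in bits n -> size s = n.
Proof.
elim: n s => [|n IHn] s /=; first by rewrite inE => /eqP ->.
by rewrite mem_cat => /orP[] /mapP[t /IHn <- ->].
Qed.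

Fixpoint flip_seq k (s : seq bool) : seq bool :=
  match s, k with
  | [::], _ => [::]
  | b :: t, 0%N => ~~ b :: t
  | b :: t, j.+1 => b :: flip_seq j t
  end.

Lemma size_flip_seq k s : size (flip_seq k s) = size s.
Proof. by elim: s k => [|b s IHs] [|k] //=; rewrite IHs. Qed.

Section Walsh.
Variable R : realFieldType.
Implicit Types (g h a : seq bool -> R) (s S : seq bool).

Definition bsum n g : R := \sum_(s <- bits n) g s.

Definition mean n g : R := bsum n g / 2 ^+ n.

Lemma bsum0 g : bsum 0 g = g [::].
Proof. by rewrite /bsum /= big_seq1. Qed.

Lemma bsumS n g :
  bsum n.+1 g = bsum n (fun s => g (false :: s)) + bsum n (fun s => g (true :: s)).
Proof. by rewrite /bsum /= big_cat !big_map. Qed.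

Lemma eq_bsum n g h : (forall s, size s = n -> g s = h s) -> bsum n g = bsum n h.
Proof. by move=> gh; apply: eq_big_seq => s /size_bits/gh. Qed.

Lemma ler_bsum n g h :
  (forall s, size s = n -> g s <= h s) -> bsum n g <= bsum n h.
Proof.
move=> gh; rewrite /bsum !big_seq.
by apply: ler_sum => s /size_bits/gh.
Qed.

Lemma bsumD n g h : bsum n (fun s => g s + h s) = bsum n g + bsum n h.
Proof. exact: big_split. Qed.

Lemma bsumB n g h : bsum n (fun s => g s - h s) = bsum n g - bsum n h.
Proof. by rewrite /bsum big_split sumrN. Qed.

Lemma bsumZ n x g : bsum n (fun s => x * g s) = x * bsum n g.
Proof. by rewrite /bsum mulr_sumr. Qed.

Lemma bsum_ge0 n g : (forall s, 0 <= g s) -> 0 <= bsum n g.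
Proof. by move=> g0; apply: sumr_ge0. Qed.

Lemma bsum_cst n x : bsum n (fun=> x) = x * 2 ^+ n.
Proof.
elim: n => [|n IHn]; first by rewrite bsum0 mulr1.
by rewrite bsumS IHn exprS; ring.
Qed.

Let pow2 n : 0 < 2 ^+ n :> R. Proof. by rewrite exprn_gt0. Qed.

Lemma mean0 g : mean 0 g = g [::].
Proof. by rewrite /mean bsum0 divr1. Qed.

Lemma meanS n g :
  mean n.+1 g = (mean n (fun s => g (false :: s)) + mean n (fun s => g (true :: s))) / 2.
Proof. by rewrite /mean bsumS exprS; field; rewrite lt0r_neq0. Qed.

Lemma eq_mean n g h : (forall s, size s = n -> g s = h s) -> mean n g = mean n h.
Proof. by move=> /eq_bsum; rewrite /mean => ->. Qed.

Lemma ler_mean n g h :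
  (forall s, size s = n -> g s <= h s) -> mean n g <= mean n h.
Proof. by move=> /ler_bsum; rewrite /mean ler_pM2r ?invr_gt0. Qed.

Lemma meanD n g h : mean n (fun s => g s + h s) = mean n g + mean n h.
Proof. by rewrite /mean bsumD mulrDl. Qed.

Lemma meanZ n x g : mean n (fun s => x * g s) = x * mean n g.
Proof. by rewrite /mean bsumZ mulrA. Qed.

Lemma mean_ge0 n g : (forall s, 0 <= g s) -> 0 <= mean n g.
Proof. by move=> g0; rewrite /mean divr_ge0 ?bsum_ge0// ltW. Qed.

(** Weighted Cauchy-Schwarz: the mean of [w * (g - t * h)^2] is a nonnegative quadratic in [t],
    evaluated at its minimiser [b / y]. If [y = 0] it is affine in [t], so its slope must vanish. *)
Lemma sqr_mean_le n w g h : (forall s, 0 <= w s) ->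
  mean n (fun s => w s * (g s * h s)) ^+ 2 <=
  mean n (fun s => w s * g s ^+ 2) * mean n (fun s => w s * h s ^+ 2).
Proof.
move=> w0; set b := mean n (fun s => w s * (g s * h s)).
set x := mean n _; set y := mean n _.
have quad t : 0 <= x - 2 * t * b + t ^+ 2 * y.
  have -> : x - 2 * t * b + t ^+ 2 * y = mean n (fun s => w s * (g s - t * h s) ^+ 2).
    rewrite /x /y /b -mulNr -!meanZ -!meanD.
    by apply: eq_mean => s _; ring.
  by apply: mean_ge0 => s; rewrite mulr_ge0 ?sqr_ge0.
have y0 : 0 <= y by apply: mean_ge0 => s; rewrite mulr_ge0 ?sqr_ge0.
have [yz|yN0] := eqVneq y 0.
  have [->|bN0] := eqVneq b 0; first by rewrite yz; lra.
  have := quad ((x + 1) / (2 * b)); rewrite yz mulr0 addr0.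
  have -> : x - 2 * ((x + 1) / (2 * b)) * b = -1 by field.
  by lra.
have := quad (b / y).
have -> : x - 2 * (b / y) * b + (b / y) ^+ 2 * y = (x * y - b ^+ 2) / y by field.
by rewrite pmulr_lge0 ?invr_gt0 ?lt0r ?yN0// subr_ge0.
Qed.

(* A set [S] of coordinates is encoded by its indicator sequence. *)
Fixpoint walsh g S : R :=
  if S is b :: S' then
    (walsh (fun s => g (false :: s)) S' +
     (-1) ^+ b * walsh (fun s => g (true :: s)) S') / 2
  else g [::].

(** The inverse Walsh transform: the function whose Walsh coefficients are [a]. *)
Fixpoint synth a s : R :=
  if s is b :: s' then
    synth (fun S => a (false :: S)) s' + (-1) ^+ b * synth (fun S => a (true :: S)) s'
  else a [::].

Definition wt S := count id S.

Lemma parseval n g : mean n (fun s => g s ^+ 2) = bsum n (fun S => walsh g S ^+ 2).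
Proof.
elim: n g => [|n IHn] g; first by rewrite mean0 bsum0.
rewrite meanS bsumS /= !IHn -!bsumD mulrC -bsumZ; apply: eq_bsum => S _.
by field.
Qed.

Lemma mean_mul_synth n g a :
  mean n (fun s => g s * synth a s) = bsum n (fun S => walsh g S * a S).
Proof.
elim: n g a => [|n IHn] g a; first by rewrite mean0 bsum0.
rewrite meanS bsumS /=.
under eq_mean do rewrite expr0 mul1r mulrDr.
under [X in _ + X]eq_mean do rewrite expr1 mulN1r mulrBr -mulN1r.
rewrite !meanD meanZ !IHn mulN1r mulrC -bsumD -bsumB -!bsumD -bsumZ.
by apply: eq_bsum => S _; field.
Qed.

(* Hypercontractivity of the noise operator of rate 1/sqrt 3 from L^2 to L^4,
   in terms of Walsh coefficients. *)
Lemma synth_pow4_le n a :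
  mean n (fun s => synth a s ^+ 4) <= bsum n (fun S => 3 ^+ wt S * a S ^+ 2) ^+ 2.
Proof.
elim: n a => [|n IHn] a; first by rewrite mean0 bsum0 /= mul1r -exprM.
rewrite meanS bsumS /= /wt /= -/wt.
set u := synth (fun S => a (false :: S)); set v := synth (fun S => a (true :: S)).
(* Averaging over the first bit cancels the terms odd in [v]. *)
have -> : (mean n (fun s => (u s + (-1) ^+ false * v s) ^+ 4) +
   mean n (fun s => (u s + (-1) ^+ true * v s) ^+ 4)) / 2 =
   mean n (fun s => u s ^+ 4) + 6 * mean n (fun s => u s ^+ 2 * v s ^+ 2) +
   mean n (fun s => v s ^+ 4).
  by rewrite -meanZ -!meanD mulrC -meanZ; apply: eq_mean => s _; field.
have uA := IHn (fun S => a (false :: S)); have vB := IHn (fun S => a (true :: S)).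
rewrite -/u -/v in uA vB.
set A := bsum n _ in uA; set B := bsum n _ in vB.
have -> : bsum n (fun S => 3 ^+ (false + count id S) * a (false :: S) ^+ 2) = A by [].
have -> : bsum n (fun S => 3 ^+ (true + count id S) * a (true :: S) ^+ 2) = 3 * B.
  by rewrite -bsumZ; apply: eq_bsum => S _; rewrite exprD expr1 mulrA.
have A0 : 0 <= A by apply: bsum_ge0 => S; rewrite mulr_ge0 ?sqr_ge0 ?exprn_ge0.
have B0 : 0 <= B by apply: bsum_ge0 => S; rewrite mulr_ge0 ?sqr_ge0 ?exprn_ge0.
have uvAB : mean n (fun s => u s ^+ 2 * v s ^+ 2) <= A * B.
  have uv0 : 0 <= mean n (fun s => u s ^+ 2 * v s ^+ 2).
    by apply: mean_ge0 => s; rewrite mulr_ge0 ?sqr_ge0.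
  rewrite -ler_sqr ?nnegrE ?uv0 ?mulr_ge0//.
  have sq4 r : 0 <= mean n (fun s => r s ^+ 4).
    by apply: mean_ge0 => s; rewrite (exprM _ 2 2) sqr_ge0.
  have := @sqr_mean_le n (fun=> 1) (fun s => u s ^+ 2) (fun s => v s ^+ 2) (fun=> ler01).
  have E r : mean n (fun s => 1 * (r s ^+ 2) ^+ 2) = mean n (fun s => r s ^+ 4).
    by apply: eq_mean => s _; rewrite mul1r -exprM.
  rewrite !E (eq_mean (h := fun s => u s ^+ 2 * v s ^+ 2)); last by move=> s; rewrite mul1r.
  by move=> /le_trans; apply; rewrite exprMn ler_pM.
apply: (le_trans (lerD (lerD uA (ler_wpM2l _ uvAB)) vB)) => //.
(* The weight 3 is what matches the cross term: [A^2 + 6AB + B^2 <= (A + 3B)^2]. *)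
have := mulr_ge0 A0 B0; have := sqr_ge0 B; nra.
Qed.

(* Dual form of [synth_pow4_le]; the exponent 3/2 comes from the L^{4/3} norm
   of a function bounded by 1. *)
Lemma noise_energy_le n g : (forall s, size s = n -> `|g s| <= 1) ->
  bsum n (fun S => 3 ^- wt S * walsh g S ^+ 2) ^+ 2 <= mean n (fun s => `|g s|) ^+ 3.
Proof.
move=> g1; set p := mean n _.
(* With this [a], the same [A] is both the pairing of [g] with [synth a] and the weighted energy of
   [synth_pow4_le]. *)
pose a S := 3 ^- wt S * walsh g S; set A := bsum n _.
have AE : A = mean n (fun s => g s * synth a s).
  by rewrite mean_mul_synth; apply: eq_bsum => S _; rewrite /a; ring.
have AE2 : A = bsum n (fun S => 3 ^+ wt S * a S ^+ 2).
  apply: eq_bsum => S _; rewrite /a; field.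
  by rewrite expf_neq0 //; lra.
have A0 : 0 <= A.
  by apply: bsum_ge0 => S; rewrite mulr_ge0 ?sqr_ge0 ?invr_ge0 ?exprn_ge0.
have p0 : 0 <= p by apply: mean_ge0.
set q := mean n (fun s => `|g s| * synth a s ^+ 2).
(* Two Cauchy-Schwarz steps replace Hölder's inequality: first with weight [|g|], then, for [q],
   with weight 1, where [g^2 <= |g|] and hypercontractivity apply. *)
have Apq : A ^+ 2 <= q * p.
  have Aabs : A <= mean n (fun s => `|g s| * (`|synth a s| * 1)).
    by rewrite AE; apply: ler_mean => s _; rewrite mulr1 -normrM ler_norm.
  have := @sqr_mean_le n (fun s => `|g s|) (fun s => `|synth a s|) (fun=> 1)
    (fun=> normr_ge0 _).
  have -> : mean n (fun s => `|g s| * `|synth a s| ^+ 2) = q.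
    by apply: eq_mean => s _; rewrite real_normK ?num_real.
  have -> : mean n (fun s => `|g s| * 1 ^+ 2) = p.
    by apply: eq_mean => s _; rewrite expr1n mulr1.
  by apply: le_trans; rewrite ler_sqr ?nnegrE// (le_trans A0).
have qAp : q ^+ 2 <= p * A ^+ 2.
  have := @sqr_mean_le n (fun=> 1) (fun s => `|g s|) (fun s => synth a s ^+ 2) (fun=> ler01).
  rewrite (eq_mean (h := fun s => `|g s| * synth a s ^+ 2)); last by move=> s; rewrite mul1r.
  move=> /le_trans; apply; apply: ler_pM.
  - by apply: mean_ge0 => s; rewrite mul1r sqr_ge0.
  - by apply: mean_ge0 => s; rewrite mul1r sqr_ge0.
  - by apply: ler_mean => s /g1 gs1; rewrite mul1r expr2 ler_piMr.
  - rewrite AE2; apply: le_trans (synth_pow4_le n a).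
    by apply: ler_mean => s _; rewrite mul1r -exprM.
(* Together [A^4 <= q^2 p^2 <= p^3 A^2]; it remains to divide by [A^2]. *)
have [A00|AN0] := eqVneq A 0; first by rewrite A00 expr0n /= exprn_ge0.
have A2_gt0 : 0 < A ^+ 2 by rewrite exprn_gt0// lt0r AN0.
rewrite -(ler_pM2l A2_gt0) -expr2.
apply: (@le_trans _ _ ((q * p) ^+ 2)); first by rewrite ler_sqr ?nnegrE ?sqr_ge0// (le_trans (ltW A2_gt0)).
have -> : A ^+ 2 * p ^+ 3 = p * A ^+ 2 * p ^+ 2 by ring.
by rewrite exprMn ler_wpM2r ?sqr_ge0.
Qed.

(** The factor 1/2 keeps the bound 1 of [g] and makes this the projection onto the Walsh
    coefficients of the sets containing [k]. *)
Definition bit_deriv k g s := (g s - g (flip_seq k s)) / 2.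

Lemma walsh_linear g h x y S :
  walsh (fun s => x * g s + y * h s) S = x * walsh g S + y * walsh h S.
Proof.
elim: S g h => [//|b S IHS] g h /=.
rewrite IHS IHS; ring.
Qed.

Lemma walsh_flip g k S :
  walsh (fun s => g (flip_seq k s)) S = (-1) ^+ nth false S k * walsh g S.
Proof.
elim: S k g => [|b S IHS] [|k] g /=; rewrite ?mul1r//.
  by case: b => /=; rewrite ?expr0 ?expr1; ring.
by rewrite (IHS k (fun s => g (false :: s))) (IHS k (fun s => g (true :: s))); ring.
Qed.

Lemma walsh_deriv g k S : walsh (bit_deriv k g) S = if nth false S k then walsh g S else 0.
Proof.
have -> : walsh (bit_deriv k g) S = walsh (fun s => 2^-1 * g s + (- 2^-1) * g (flip_seq k s)) S.
  rewrite /bit_deriv; congr walsh; apply/funext => s; ring.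
rewrite walsh_linear walsh_flip; case: (nth _ _ _); first by field.
by ring.
Qed.

Lemma walsh0 g n : walsh g (nseq n false) = mean n g.
Proof. by elim: n g => [|n IHn] g; rewrite ?mean0// meanS /= !IHn mul1r. Qed.

Lemma wtE n S : size S = n -> (wt S)%:R = \sum_(0 <= k < n) (nth false S k)%:R :> R.
Proof.
elim: n S => [[]//= _|n IHn [//|b S] /= [Sn]]; first by rewrite big_nil.
by rewrite /wt /= natrD -/(wt S) (IHn S Sn) big_nat_recl.
Qed.

(** Each [S] contributes once for every [k] in it. It serves with [c = 1] (energy) and [c i = 3^-i]
    (noisy energy). *)
Lemma sum_deriv n g (c : nat -> R) :
  \sum_(0 <= k < n) bsum n (fun S => c (wt S) * walsh (bit_deriv k g) S ^+ 2) =
  bsum n (fun S => (wt S)%:R * (c (wt S) * walsh g S ^+ 2)).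
Proof.
rewrite /bsum exchange_big; apply: eq_big_seq => S /size_bits Sn /=.
rewrite (wtE Sn) mulr_suml; apply: eq_bigr => k _.
by rewrite walsh_deriv; case: nth; rewrite ?mul1r// expr0n /= mulr0 mul0r.
Qed.

Definition cube_var n g := mean n (fun s => g s ^+ 2) - mean n g ^+ 2.

Lemma bsum_nseq0 n g : bsum n (fun S => if wt S == 0%N then 0 else g S) = bsum n g - g (nseq n false).
Proof.
elim: n g => [|n IHn] g; first by rewrite !bsum0 /= subrr.
rewrite !bsumS /= IHn.
ring.
Qed.

Lemma cube_varE n g :
  cube_var n g = bsum n (fun S => if wt S == 0%N then 0 else walsh g S ^+ 2).
Proof. by rewrite /cube_var parseval bsum_nseq0 walsh0. Qed.

End Walsh.

(** * The Kahn-Kalai-Linial inequality on the finite cube *)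

Section KKL.
Variable R : rcfType.
Implicit Types (g : seq bool -> R).

(** [p k] will be the influence of bit [k]. The second bound is the Poincaré inequality, which
    handles [delta] not small. *)
Lemma cube_var_le n g (p : nat -> R) delta d : (0 < d)%N ->
  (forall s, size s = n -> `|g s| <= 1) ->
  (forall k, mean n (fun s => `|bit_deriv k g s|) <= p k) ->
  (forall k, p k <= delta) ->
  cube_var n g <= (3 ^+ d * Num.sqrt delta + d%:R^-1) * \sum_(0 <= k < n) p k
  /\ cube_var n g <= \sum_(0 <= k < n) p k.
Proof.
move=> d0 g1 gp pd.
have dg1 k s : size s = n -> `|bit_deriv k g s| <= 1.
  move=> sn; have := g1 s sn; have := g1 (flip_seq k s); rewrite size_flip_seq => /(_ sn).
  by rewrite /bit_deriv !ler_norml => /andP[a b] /andP[c e]; apply/andP; lra.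
have p0 k : 0 <= p k by apply: le_trans (gp k); apply: mean_ge0.
have delta0 : 0 <= delta by exact: le_trans (p0 0%N) (pd 0%N).
have d_gt0 : 0 < d%:R :> R by rewrite ltr0n.
have energy : bsum n (fun S => (wt S)%:R * (1 * walsh g S ^+ 2)) <=
    \sum_(0 <= k < n) p k.
  rewrite -(sum_deriv n g (fun=> 1)); apply: ler_sum => k _.
  under eq_bsum do rewrite mul1r.
  rewrite -parseval; apply: le_trans (gp k); apply: ler_mean => s sn.
  by rewrite -real_normK ?num_real// expr2 ler_piMr// dg1.
have noise : bsum n (fun S => (wt S)%:R * (3 ^- wt S * walsh g S ^+ 2)) <=
    Num.sqrt delta * \sum_(0 <= k < n) p k.
  rewrite -(sum_deriv n g (fun i => 3 ^- i)) mulr_sumr; apply: ler_sum => k _.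
  have A0 : 0 <= bsum n (fun S => 3 ^- wt S * walsh (bit_deriv k g) S ^+ 2).
    by apply: bsum_ge0 => S; rewrite mulr_ge0 ?sqr_ge0 ?invr_ge0 ?exprn_ge0.
  (* After squaring, the noise bound gives at most [p k ^+ 3], and one factor [p k] is replaced by
     [delta]. *)
  rewrite -ler_sqr ?nnegrE ?A0 ?mulr_ge0 ?sqrtr_ge0 ?sumr_ge0//.
  apply: (le_trans (noise_energy_le (dg1 k))); rewrite [(Num.sqrt _ * _) ^+ 2]exprMn sqr_sqrtr//.
  have m0 : 0 <= mean n (fun s => `|bit_deriv k g s|) by apply: mean_ge0.
  apply: (@le_trans _ _ (p k ^+ 3)); first by rewrite lerXn2r ?nnegrE.
  by rewrite exprS ler_wpM2r ?sqr_ge0.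
split; last first.
  apply: le_trans energy; rewrite cube_varE; apply: ler_bsum => S _.
  rewrite mul1r; case: ifP => [_|/negbT]; first by rewrite mulr_ge0 ?sqr_ge0.
  by rewrite -lt0n => S0; rewrite ler_peMl ?sqr_ge0// ler1n.
have := lerD (ler_wpM2l (exprn_ge0 d (ler0n R 3)) noise)
  (ler_wpM2l (ltW (etrans (invr_gt0 _) d_gt0)) energy).
rewrite mulrA -mulrDl; apply: le_trans; rewrite -!bsumZ -bsumD cube_varE.
apply: ler_bsum => S _; have W0 := sqr_ge0 (walsh g S).
have pos1 : 0 <= 3 ^+ d * ((wt S)%:R * (3 ^- wt S * walsh g S ^+ 2)).
  by rewrite mulr_ge0 ?exprn_ge0// mulr_ge0// mulr_ge0// invr_ge0 exprn_ge0.
have pos2 : 0 <= d%:R^-1 * ((wt S)%:R * (1 * walsh g S ^+ 2)).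
  by rewrite mul1r mulr_ge0 ?invr_ge0// mulr_ge0.
case: ifP => [_|/negbT]; first by rewrite addr_ge0.
(* For [wt S <= d] the noisy term alone has coefficient at least 1, as [3^d / 3^(wt S) >= 1]; for
   larger [S] the energy term does, as [wt S / d >= 1]. *)
rewrite -lt0n => S0; have [Sd|/ltnW dS] := leqP (wt S) d.
  apply: ler_wpDr => //.
  have -> : 3 ^+ d * ((wt S)%:R * (3 ^- wt S * walsh g S ^+ 2)) =
      (3 ^+ d / 3 ^+ wt S * (wt S)%:R) * walsh g S ^+ 2 by ring.
  rewrite ler_peMl// mulr_ege1// ?ler1n// ler_pdivlMr ?exprn_gt0// mul1r.
  by rewrite ler_weXn2l// ler1n.
apply: ler_wpDl => //.
have -> : d%:R^-1 * ((wt S)%:R * (1 * walsh g S ^+ 2)) =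
      ((wt S)%:R / d%:R) * walsh g S ^+ 2 by ring.
by rewrite ler_peMl// ler_pdivlMr// mul1r ler_nat.
Qed.

End KKL.

(** * Events of the infinite product *)

(** The offset [m] lets inductions on [s] peel off its first bit. *)
Definition cyl m (s : seq bool) : set Omega_inf :=
  [set w | forall i, (i < size s)%N -> w (m + i)%N = nth false s i].

Definition level n (B : set Omega_inf) :=
  forall w w' : Omega_inf, (forall i, (i < n)%N -> w i = w' i) -> B w -> B w'.

Lemma cyl_nil m : cyl m [::] = setT.
Proof. by apply/seteqP; split. Qed.

Lemma cyl_cons m b s : cyl m (b :: s) = [set w | w m = b] `&` cyl m.+1 s.
Proof.
apply/seteqP; split => [w ws|w [wb ws] [|i] /= si].
- split => [|i si]; first by have := ws 0%N isT; rewrite addn0.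
  by have := ws i.+1 si; rewrite addnS.
- by rewrite addn0.
- by rewrite addnS; exact: ws.
Qed.

Lemma measurable_coord i b : measurable ([set w | w i = b] : set Omega_inf).
Proof. by apply: sub_sigma_algebra; exists i, b. Qed.

Lemma measurable_cyl m s : measurable (cyl m s).
Proof.
elim: s m => [|b s IHs] m; first by rewrite cyl_nil.
by rewrite cyl_cons; apply: measurableI => //; exact: measurable_coord.
Qed.

Lemma level_widen n m B : (n <= m)%N -> level n B -> level m B.
Proof.
move=> nm nB w w' ww'; apply: nB => i iltn.
by apply: ww'; exact: leq_trans nm.
Qed.

Lemma level_cyl n B s w : level n B -> size s = n -> cyl 0 s w ->
  B w <-> B (nth false s).
Proof.
by move=> nB sn ws; split; apply: nB => i iltn; [|symmetry];
   apply: ws; rewrite sn.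
Qed.

Lemma measurable_level n B : level n B -> measurable B.
Proof.
(* [B] is a union of cylinders over the countable type of all bit sequences, those of wrong length
   or outside [B] giving [set0]. The point [nth false s] pads [s] with [false]. *)
move=> nB; pose F (s : seq bool) := if `[< size s = n /\ B (nth false s) >] then cyl 0 s else set0.
have -> : B = \bigcup_s F s.
  apply/seteqP; split => [w Bw|w [s _]]; last first.
    by rewrite /F; case: asboolP => // -[sn Bs] /(level_cyl nB sn) ->.
  have ws : cyl 0 (mkseq w n) w.
    by move=> i; rewrite size_mkseq => iltn; rewrite nth_mkseq.
  exists (mkseq w n) => //; rewrite /F; case: asboolP => // -[].
  by split; [rewrite size_mkseq|apply/(level_cyl nB _ ws) => //; rewrite size_mkseq].
apply: countable_bigcupT_measurable => [|s]; first exact: countableP.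
by rewrite /F; case: asboolP => // _; exact: measurable_cyl.
Qed.

Lemma levelI n m A B : level n A -> level m B -> level (maxn n m) (A `&` B).
Proof.
move=> nA mB w w' ww' [Aw Bw]; split.
- exact: (level_widen (leq_maxl n m) nA) Aw.
- exact: (level_widen (leq_maxr n m) mB) Bw.
Qed.

Lemma levelC n A : level n A -> level n (~` A).
Proof. by move=> nA w w' ww' Aw Aw'; apply: Aw; apply: nA Aw' => i /ww'. Qed.

Lemma levelU n m A B : level n A -> level m B -> level (maxn n m) (A `|` B).
Proof.
move=> nA mB; rewrite -[_ `|` _]setCK setCU.
by apply: levelC; apply: levelI; exact: levelC.
Qed.

Lemma level_coord i b : level i.+1 [set w | w i = b].
Proof. by move=> w w' /(_ i (leqnn _)) /= ->. Qed.

(** Unlike the coordinate events, these generators are closed under intersection, as uniqueness of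
    measures requires. *)
Lemma measurable_levels : @measurable _ Omega_inf = <<s [set B | exists n, level n B] >>.
Proof.
apply/seteqP; split.
- apply: smallest_sub; first exact: smallest_sigma_algebra.
  move=> _ [i [b ->]]; apply: sub_sigma_algebra; exists i.+1; exact: level_coord.
- apply: smallest_sub; first exact: sigma_algebra_measurable.
  by move=> B [n /measurable_level].
Qed.

Lemma flipK k : involutive (flip k).
Proof. by move=> w; apply/funext => i; rewrite /flip; case: eqP => // _; rewrite negbK. Qed.

Lemma measurable_flip k : measurable_fun setT (flip k : Omega_inf -> Omega_inf).
Proof.
apply: (@measurability _ _ _ _ _ _ [set B | exists n, level n B]).
  exact: measurable_levels.
move=> _ [B [n nB] <-]; rewrite setTI; apply: (@measurable_level n).
by move=> w w' ww'; apply: nB => i /ww'; rewrite /flip => ->.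
Qed.

Lemma measurable_preimage_flip k A : measurable A -> measurable (flip k @^-1` A).
Proof. by move=> mA; rewrite -[_ @^-1` _]setTI; exact: measurable_flip. Qed.

Lemma nth_flip_seq k s i : (i < size s)%N ->
  nth false (flip_seq k s) i = if i == k then ~~ nth false s i else nth false s i.
Proof. by elim: s k i => [|b s IHs] [|k] [|i] //=; exact: IHs. Qed.

Lemma preimage_flip_cyl k s : flip k @^-1` cyl 0 s = cyl 0 (flip_seq k s).
Proof.
apply/seteqP; split => w ws i.
- rewrite size_flip_seq => si; have := ws i si; rewrite nth_flip_seq// /flip !add0n.
  by case: eqP => _ <-; rewrite ?negbK.
- move=> si; have := ws i; rewrite size_flip_seq nth_flip_seq// /flip !add0n => /(_ si) ->.
  by case: eqP => _; rewrite ?negbK.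
Qed.

(** * Approximation of measurable events by finitely determined ones *)

Section Prob.
Variables (R : realType) (P : probability Omega_inf R).
Implicit Types A B : set Omega_inf.

Definition pr A : R := fine (P A).

Lemma prE A : measurable A -> P A = (pr A)%:E.
Proof. by move=> mA; rewrite /pr fineK// fin_num_measure. Qed.

Lemma pr_ge0 A : 0 <= pr A.
Proof. by rewrite /pr fine_ge0. Qed.

Lemma pr_le A B : measurable A -> measurable B -> A `<=` B -> pr A <= pr B.
Proof.
by move=> mA mB AB; rewrite -lee_fin -!prE//; apply: le_measure; rewrite ?inE.
Qed.

Lemma prT : pr setT = 1.
Proof. by rewrite /pr probability_setT. Qed.

Lemma pr0 : pr set0 = 0.
Proof. by rewrite /pr measure0. Qed.

Lemma pr_split A B : measurable A -> measurable B ->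
  pr A = pr (A `\` B) + pr (A `&` B).
Proof.
move=> mA mB; have mAB := measurableD mA mB; have mI := measurableI _ _ mA mB.
by apply/EFin_inj; rewrite EFinD -!prE// -measureDI.
Qed.

Lemma pr_setU_le A B : measurable A -> measurable B -> pr (A `|` B) <= pr A + pr B.
Proof.
move=> mA mB; rewrite -lee_fin EFinD -!prE//; first exact: measureU2.
exact: measurableU.
Qed.

Lemma measurable_setY A B : measurable A -> measurable B -> measurable (A `+` B).
Proof. by move=> mA mB; rewrite setY_def; apply: measurableU; exact: measurableD. Qed.

Lemma bsum_pr_cyl n m A : measurable A -> bsum n (fun s => pr (A `&` cyl m s)) = pr A.
Proof.
elim: n m A => [|n IHn] m A mA; first by rewrite bsum0 cyl_nil setIT.
have mC b : measurable (A `&` [set w | w m = b]).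
  by apply: measurableI => //; exact: measurable_coord.
rewrite bsumS.
under eq_bsum do rewrite cyl_cons setIA.
under [X in _ + X]eq_bsum do rewrite cyl_cons setIA.
rewrite !IHn// [RHS](pr_split mA (measurable_coord m true)); congr (pr _ + _).
rewrite setDE; congr (_ `&` _); apply/seteqP.
by split => w /=; case: (w m).
Qed.

(* Approximable sets form a sigma-algebra containing the coordinate events. *)
Lemma level_dense A e : measurable A -> 0 < e ->
  exists n B, level n B /\ pr (A `+` B) <= e.
Proof.
pose E := [set A | measurable A /\
  forall e : R, 0 < e -> exists n B, level n B /\ pr (A `+` B) <= e].
suff EA : measurable `<=` E by move=> mA; apply: (EA _ mA).2.
have EU A1 A2 : E A1 -> E A2 -> E (A1 `|` A2).
  move=> [mA1 E1] [mA2 E2]; split; first exact: measurableU.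
  move=> r r0; have r20 : 0 < r / 2 by rewrite divr_gt0.
  have [n1 [B1 [l1 b1]]] := E1 _ r20; have [n2 [B2 [l2 b2]]] := E2 _ r20.
  exists (maxn n1 n2), (B1 `|` B2); split; first exact: levelU.
  have mB1 := measurable_level l1; have mB2 := measurable_level l2.
  rewrite [r]splitr; apply: le_trans (lerD b1 b2).
  apply: (le_trans _ (pr_setU_le (measurable_setY mA1 mB1) (measurable_setY mA2 mB2))).
  apply: pr_le; rewrite ?setY_def.
  - by apply: measurableU; apply: measurableD; exact: measurableU.
  - by apply: measurableU; apply: measurableU; exact: measurableD.
  - by move=> w; rewrite /setD /=; tauto.
have E0 : E set0.
  split=> // r r0; exists 0%N, set0; split; first by [].
  by rewrite setYK pr0 ltW.
have EUc (F : nat -> set Omega_inf) : (forall k, E (F k)) -> E (\bigcup_k F k).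
  move=> EF; have mF k : measurable (F k) by case: (EF k).
  have mUF : measurable (\bigcup_k F k) by exact: bigcupT_measurable.
  split=> // r r0; pose G N := \bigcup_(k < N) F k.
  have EG N : E (G N).
    rewrite /G bigcup_mkord; elim: N => [|N IHN]; first by rewrite big_ord0.
    by rewrite big_ord_recr /=; exact: EU.
  have mG N : measurable (G N) by case: (EG N).
  have r20 : 0 < r / 2 by rewrite divr_gt0.
  have GF : \bigcup_N G N = \bigcup_k F k.
    apply/seteqP; split => [w [N _ [k _ Fk]]|w [k _ Fk]]; first by exists k.
    by exists k.+1 => //; exists k => //=.
  (* By continuity from below, a finite subunion loses at most half of the error; approximating it
     costs the other half. *)
  have [N prN] : exists N, pr (\bigcup_k F k) - r / 2 < pr (G N).
    have ndG : {homo G : n m / (n <= m)%N >-> (n <= m)%O}.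
      move=> n m nm; apply/subsetPset => w [k /= kn Fk]; exists k => //=.
      exact: leq_trans nm.
    have : (P \o G) @ \oo --> P (\bigcup_k F k).
      by rewrite -GF; exact: nondecreasing_cvg_mu mG (bigcupT_measurable _ mG) ndG.
    rewrite prE// => /fine_cvg /cvgrPdist_lt /(_ _ r20)[N _ /(_ N (leqnn N))] /= h.
    by exists N; move: h; rewrite /pr ltr_norml => /andP[_]; lra.
  have [n [B [lB bB]]] := (EG N).2 _ r20.
  have mB := measurable_level lB.
  exists n, B; split=> //.
  have mD : measurable (\bigcup_k F k `\` G N) by exact: measurableD.
  have prD : pr (\bigcup_k F k `\` G N) <= r / 2.
    have := pr_split mUF (mG N); rewrite (_ : _ `&` G N = G N); first by lra.
    by apply: setIidr => w Gw; rewrite -GF; exists N.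
  rewrite [r]splitr; apply: le_trans (lerD prD bB).
  apply: (le_trans _ (pr_setU_le mD (measurable_setY (mG N) mB))).
  apply: pr_le; rewrite ?setY_def.
  - by apply: measurableU; exact: measurableD.
  - by apply: measurableU => //; apply: measurableU; exact: measurableD.
  - have GsubF : G N `<=` \bigcup_k F k by move=> w Gw; rewrite -GF; exists N.
    move=> w; rewrite /setD /=; have := GsubF w; have := pselect (G N w); tauto.
apply: smallest_sub; last first.
  move=> _ [i [b ->]]; split; first exact: measurable_coord.
  move=> r r0; exists i.+1, [set w | w i = b]; split; first exact: level_coord.
  by rewrite setYK pr0 ltW.
split; [exact: E0| |exact: EUc].
move=> A0 [mA E0A]; rewrite setTD; split; first exact: measurableC.
move=> r /E0A[n [B [lB bB]]]; exists n, (~` B); split; first exact: levelC.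
suff -> : ~` A0 `+` ~` B = A0 `+` B by [].
rewrite !setY_def !setDE !setCK setUC; congr (_ `|` _); exact: setIC.
Qed.

Hypothesis uP : uniform_product P.

Lemma pr_cyl s : pr (cyl 0 s) = 2 ^- size s.
Proof. by rewrite /pr uP /= div1r exprVn. Qed.

Lemma pr_level n B : level n B -> pr B = mean n (fun s => `[< B (nth false s) >]%:R).
Proof.
move=> lB; have mB := measurable_level lB.
rewrite -(bsum_pr_cyl n 0 mB) /mean mulrC -bsumZ; apply: eq_bsum => s sn.
case: asboolP => Bs.
- rewrite (_ : B `&` _ = cyl 0 s) ?pr_cyl ?sn ?mulr1//.
  by apply: setIidr => w ws; apply/(level_cyl lB sn ws).
- rewrite (_ : B `&` _ = set0) ?pr0 ?mulr0//.
  by apply/seteqP; split => // w [Bw ws]; apply: Bs; apply/(level_cyl lB sn ws).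
Qed.

End Prob.

(** * Conditional expectations *)

Lemma bsum_flip_seq (R : realFieldType) n k (h : seq bool -> R) :
  bsum n (fun s => h (flip_seq k s)) = bsum n h.
Proof.
elim: n k h => [|n IHn] [|k] h; rewrite ?bsum0// !bsumS /=; first by rewrite addrC.
by rewrite !(IHn k (fun s => h (_ :: s))).
Qed.

(* The cut-off level is d = floor (L / 8), where L = ln (1 / delta). *)
Lemma mul_ln_le (R : realType) (V I delta : R) : 0 <= V -> 0 < delta ->
  V <= I -> (forall d, (0 < d)%N -> V <= (3 ^+ d * Num.sqrt delta + d%:R^-1) * I) ->
  V * ln delta^-1 <= 20 * I.
Proof.
move=> V0 d0 VI VdI; have I0 := le_trans V0 VI.
(* For [L < 8] the cut-off would be 0, but then [V <= I] suffices. *)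
set L := ln delta^-1; have [L8|L8] := ltP L 8.
  apply: (@le_trans _ _ (V * 8)); first by rewrite ler_wpM2l// ltW.
  nra.
have L0 : 0 < L by lra.
have deltaE : Num.sqrt delta = expR (- (L / 2)).
  rewrite -[LHS]ger0_norm ?sqrtr_ge0// -[RHS]ger0_norm ?expR_ge0// -!sqrtr_sqr.
  rewrite sqr_sqrtr ?ltW// -expRM_natl.
  rewrite (_ : 2%:R * _ = - L); last by field.
  by rewrite /L lnV ?posrE// opprK lnK ?posrE.
pose d := Num.truncn (L / 8).
have L80 : 0 <= L / 8 by lra.
have /andP[dL Ld] := truncn_itv L80; rewrite -/d in dL Ld.
have d_gt0 : (0 < d)%N.
  by rewrite lt0n; apply/eqP => dE; move: Ld; rewrite dE => Ld; lra.
have d1 : 1 <= d%:R :> R by rewrite ler1n.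
(* Since [d >= 1], [2 * d >= d + 1 > L / 8]. *)
have dinv : d%:R^-1 <= 16 / L.
  rewrite -[X in X <= _]mul1r ler_pdivrMr ?(lt_le_trans ltr01)// mulrAC ler_pdivlMr// mul1r.
  by move: Ld; rewrite -[d.+1%:R]natr1 => Ld; lra.
(* Here [3 <= e^2] and [d <= L / 8]; against [sqrt delta = e^(-L/2)] this leaves
   [e^(-L/4) <= 4 / L]. *)
have e3 : 3 ^+ d <= expR (L / 4).
  apply: (@le_trans _ _ (expR 2 ^+ d)).
    by rewrite lerXn2r ?nnegrE ?expR_ge0//; have := expR_ge1Dx (2 : R); lra.
  rewrite -expRM_natl ler_expR; lra.
have small : 3 ^+ d * Num.sqrt delta <= 4 / L.
  rewrite deltaE; apply: (@le_trans _ _ (expR (L / 4) * expR (- (L / 2)))).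
    by rewrite ler_wpM2r ?expR_ge0.
  rewrite -expRD (_ : L / 4 + - (L / 2) = - (L / 4)); last by field.
  rewrite expRN -[4 / L]invf_div lef_pV2 ?posrE ?expR_gt0 ?divr_gt0//.
  by have := expR_ge1Dx (L / 4); lra.
apply: (@le_trans _ _ ((4 / L + 16 / L) * I * L)).
  rewrite ler_pM2r//; apply: le_trans (VdI d d_gt0) _.
  by rewrite ler_wpM2r// lerD.
rewrite le_eqVlt; apply/orP; left; apply/eqP; field; exact: lt0r_neq0.
Qed.

Section CondAvg.
Variables (R : realType) (P : probability Omega_inf R).
Hypothesis uP : uniform_product P.
Implicit Types A B : set Omega_inf.
Local Notation pr := (pr P).

(** The image measure under the flip agrees with [P] on finitely determined events, where the flip
    merely permutes the cube; uniqueness of measures does the rest. *)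
Lemma pr_flip k A : measurable A -> pr (flip k @^-1` A) = pr A.
Proof.
move=> mA; rewrite /pr; congr fine.
rewrite -[LHS]/(pushforward P (flip k) A).
apply: (measure_unique [set B | exists n, level n B] (fun=> setT)) => //.
- exact: measurable_levels.
- by move=> B C [n lB] [m lC]; exists (maxn n m); exact: levelI.
- by move=> _; exists 0%N.
- by rewrite bigcup_const.
- exact: measurable_flip.
- move=> Hf B [n lB].
  have lB' : level n (flip k @^-1` B).
    by move=> w w' ww'; apply: lB => i /ww'; rewrite /flip => ->.
  rewrite /= /pushforward !prE; [|exact: measurable_level lB|exact: measurable_level lB'].
  rewrite (pr_level uP lB) (pr_level uP lB') /mean -[in RHS](bsum_flip_seq n k).
  congr ((_ / _)%:E); apply: eq_bsum => s sn; congr ((nat_of_bool _)%:R); apply: asbool_equiv_eq.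
  have ns : cyl 0 (flip_seq k s) (flip k (nth false s)).
    by move=> i; rewrite size_flip_seq add0n => si; rewrite nth_flip_seq.
  by apply: (level_cyl lB _ ns); rewrite size_flip_seq.
- by move=> Hf _; rewrite /= /pushforward preimage_setT probability_setT ltry.
Qed.

(* The conditional expectation of 2 1_A - 1 given the first [n = size s] bits,
   on the event that they are equal to [s]. *)
Definition cond_sgn n A s : R := 2 * (2 ^+ n * pr (A `&` cyl 0 s)) - 1.

Let pow2 n : 0 < 2 ^+ n :> R. Proof. by rewrite exprn_gt0. Qed.

Lemma mean_pow2 n (h : seq bool -> R) : mean n (fun s => 2 ^+ n * h s) = bsum n h.
Proof. by rewrite meanZ /mean mulrC divfK ?lt0r_neq0. Qed.

Lemma mean_cst n (x : R) : mean n (fun=> x) = x.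
Proof. by rewrite /mean bsum_cst mulfK ?lt0r_neq0. Qed.

Let density n A s : measurable A -> size s = n ->
  0 <= 2 ^+ n * pr (A `&` cyl 0 s) <= 1.
Proof.
move=> mA sn; have mC := measurable_cyl 0 s; apply/andP; split.
  by rewrite mulr_ge0 ?pr_ge0// ltW.
rewrite -[leRHS](mulfV (lt0r_neq0 (pow2 n))) ler_pM2l// -[in leRHS]sn -(pr_cyl uP).
by apply: pr_le => //; exact: measurableI.
Qed.

Lemma cond_sgn_norm_le1 n A s : measurable A -> size s = n -> `|cond_sgn n A s| <= 1.
Proof.
move=> mA sn; have /andP[a0 a1] := density mA sn.
by rewrite /cond_sgn ler_norml; apply/andP; lra.
Qed.

Lemma mean_cond_sgn n A : measurable A -> mean n (cond_sgn n A) = 2 * pr A - 1.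
Proof.
move=> mA; rewrite /cond_sgn meanD meanZ mean_pow2 mean_cst.
by rewrite (bsum_pr_cyl P n 0 mA).
Qed.

Lemma pr_setY_cyl_ge A B C : measurable A -> measurable B -> measurable C ->
  `|pr (A `&` C) - pr (B `&` C)| <= pr ((A `+` B) `&` C).
Proof.
move=> mA mB mC.
have half X Y : measurable X -> measurable Y ->
    pr (X `&` C) - pr (Y `&` C) <= pr ((X `+` Y) `&` C).
  move=> mX mY; have mY' := measurable_setY mX mY; rewrite lerBlDl.
  apply: (le_trans _ (pr_setU_le P (measurableI _ _ mY mC) (measurableI _ _ mY' mC))).
  apply: pr_le; [exact: measurableI|by apply: measurableU; exact: measurableI|].
  by move=> w [Xw Cw]; rewrite setY_def; have := pselect (Y w); rewrite /setD /=; tauto.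
by rewrite ler_norml lerNl opprB half// setYC half.
Qed.

(** By flip invariance, the mass of [A] in the flipped cylinder is that of the flipped [A] in the
    original one, so the derivative compares two events in one cylinder. The 2 of [cond_sgn] cancels
    the 1/2 of [bit_deriv]. *)
Lemma mean_deriv_cond_sgn n k A : measurable A ->
  mean n (fun s => `|bit_deriv k (cond_sgn n A) s|) <= pr (A `+` flip k @^-1` A).
Proof.
move=> mA; have mA' := measurable_preimage_flip k mA.
have mY := measurable_setY mA mA'.
rewrite -(bsum_pr_cyl P n 0 mY) -mean_pow2; apply: ler_mean => s sn.
have mC := measurable_cyl 0 s.
have -> : bit_deriv k (cond_sgn n A) s =
    2 ^+ n * (pr (A `&` cyl 0 s) - pr (flip k @^-1` A `&` cyl 0 s)).
  have -> : pr (flip k @^-1` A `&` cyl 0 s) = pr (A `&` cyl 0 (flip_seq k s)).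
    rewrite -(pr_flip k (measurableI _ _ mA' mC)) preimage_setI preimage_flip_cyl.
    congr (pr (_ `&` _)); apply/seteqP; split => w /=; by rewrite /preimage /= flipK.
  by rewrite /bit_deriv /cond_sgn; field.
by rewrite normrM gtr0_norm// ler_pM2l// pr_setY_cyl_ge.
Qed.

(* If B is a union of cylinders, min (a, 1 - a) is at most the relative measure
   of the symmetric difference of A and B in each of them, where a is that of A. *)
Lemma mean_sqr_cond_sgn n A B : measurable A -> level n B ->
  1 - 4 * pr (A `+` B) <= mean n (fun s => cond_sgn n A s ^+ 2).
Proof.
move=> mA lB; have mB := measurable_level lB.
have mY := measurable_setY mA mB.
rewrite -(bsum_pr_cyl P n 0 mY) -mean_pow2 -[X in X - _](mean_cst n) -mulNr -meanZ -meanD.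
apply: ler_mean => s sn; have mC := measurable_cyl 0 s.
have /andP[a0 a1] := density mA sn; rewrite /cond_sgn.
set a := 2 ^+ n * _ in a0 a1 *; set b := 2 ^+ n * _.
(* Either value suffices because [(2a - 1)^2 = 1 - 4a(1 - a)]. *)
suff : b = a \/ b = 1 - a by case=> ->; nra.
have [Bs|nBs] := pselect (B (nth false s)); [right|left].
  have -> : b = 2 ^+ n * pr (cyl 0 s `\` A).
    rewrite /b; congr (_ * pr _); apply/seteqP; rewrite setY_def.
    by split => w /=; have := level_cyl (s := s) (w := w) lB sn; rewrite /setD /=; tauto.
  have := pr_split P mC mA; rewrite pr_cyl// sn setIC => h.
  rewrite (_ : pr _ = 2 ^- n - pr (A `&` cyl 0 s)); last by rewrite h addrK.
  by rewrite mulrBr mulfV ?lt0r_neq0.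
rewrite /a /b; congr (_ * pr _); apply/seteqP; rewrite setY_def.
by split => w /=; have := level_cyl (s := s) (w := w) lB sn; rewrite /setD /=; tauto.
Qed.

Lemma variance_sgn (f : Omega_inf -> R) : measurable_fun setT f ->
  (forall w, f w = 1 \/ f w = -1) ->
  'V_P[f]%E = (1 - (2 * pr [set w | f w = 1] - 1) ^+ 2)%:E.
Proof.
move=> mf f1; set A := [set w | f w = 1].
have mA : measurable A.
  by have := mf measurableT _ (measurable_set1 1); rewrite setTI.
have fE : f = (2 \o* \1_A) \+ cst (-1).
  apply/funext => w /=; rewrite indicE.
  have [Aw|nAw] := pselect (A w); first by rewrite mem_set// Aw mulr1n; lra.
  by rewrite memNset// mulr0n; case: (f1 w) => // ->; lra.
have affine (a b : R) : 'E_P[(a \o* \1_A) \+ cst b]%E = (a * pr A + b)%:E.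
  have i1 : P.-integrable setT (fun w => a%:E * (\1_A w)%:E)%E.
    by apply: integrableZl => //; exact: integrable_indic.
  rewrite unlock; under eq_integral do rewrite /= mulrC EFinD EFinM.
  rewrite integralD//; last exact: finite_measure_integrable_cst.
  rewrite integralZl//; last exact: integrable_indic.
  by rewrite integral_indic// setIT integral_cst//= probability_setT mule1 prE.
rewrite /variance covariance.unlock fE affine /=; set c := 2 * pr A - 1.
(* An indicator equals its square, so [(f - c)^2] is again affine in it: [(1 - c)^2] on [A] and
   [(1 + c)^2] off [A]. *)
rewrite (_ : (_ * _)%R = (- 4 * c) \o* \1_A \+ cst (1 + 2 * c + c ^+ 2)).
  by rewrite affine; congr (_%:E); rewrite /c; ring.
apply/funext => w; rewrite /= !fctE /= indicE.
by case: (w \in A); rewrite ?mulr1n ?mulr0n; rewrite /c; ring.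
Qed.

End CondAvg.

(** * Transfer from the finite cubes to the infinite product *)

Lemma influence_sgn (R : realType) (P : probability Omega_inf R) (f : Omega_inf -> R) k :
  (forall w, f w = 1 \/ f w = -1) ->
  influence P f k = pr P ([set w | f w = 1] `+` flip k @^-1` [set w | f w = 1]).
Proof.
move=> f1; rewrite /influence /pr; congr (fine (P _)); rewrite setY_def.
have N11 : (-1 : R) <> 1 by move=> /eqP; rewrite eq_sym -subr_eq0 opprK (@pnatr_eq0 R 2).
apply/seteqP; rewrite /setD /preimage; split => w /=; last first.
  by move=> [] [a b]; apply/eqP => h; apply: b; rewrite -a h.
case: (f1 w) => -> ; case: (f1 (flip k w)) => ->; rewrite ?eqxx// => _; [left|right]; split=> //.
Qed.

Lemma variance_ln_le (R : realType) (P : probability Omega_inf R)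
    (A : set Omega_inf) (delta : R) :
  uniform_product P -> measurable A -> 0 < delta <= 1 ->
  (forall k, pr P (A `+` flip k @^-1` A) <= delta) ->
  forall e, 0 < e -> exists n,
  (1 - (2 * pr P A - 1) ^+ 2) * ln delta^-1 <=
  20 * (\sum_(0 <= k < n) pr P (A `+` flip k @^-1` A)) + e.
Proof.
move=> uP mA /andP[d0 d1] Ad e e0.
set L := ln delta^-1.
have L0 : 0 <= L by rewrite ln_ge0// invf_ge1.
(* The variance error is 4 times this accuracy, hence at most [e] after multiplication by [L];
   [L + 1] avoids dividing by 0 when [delta = 1]. *)
have r0 : 0 < e / (4 * (L + 1)) by rewrite divr_gt0// mulr_gt0// ltr_wpDl.
have [n [B [lB AB]]] := level_dense P mA r0; exists n.
set g := cond_sgn P n A.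
have meang : mean n g = 2 * pr P A - 1 by exact: mean_cond_sgn.
have cube_var_ge0 : 0 <= cube_var n g.
  by rewrite cube_varE; apply: bsum_ge0 => S; case: ifP; rewrite ?sqr_ge0.
have key d : (0 < d)%N -> _ := fun d_gt0 => cube_var_le d_gt0
  (fun s => @cond_sgn_norm_le1 R P uP n A s mA) (fun k => mean_deriv_cond_sgn uP n k mA) Ad.
have := mul_ln_le cube_var_ge0 d0 (key 1%N isT).2 (fun d dpos => (key d dpos).1).
rewrite -/L -/g => VL.
have := mean_sqr_cond_sgn uP mA lB; rewrite -/g => g2.
have V4 : 1 - (2 * pr P A - 1) ^+ 2 <= cube_var n g + 4 * (e / (4 * (L + 1))).
  by rewrite /cube_var meang; lra.
apply: (le_trans (ler_wpM2r L0 V4)); rewrite mulrDl lerD//.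
have -> : 4 * (e / (4 * (L + 1))) * L = e * (L / (L + 1)) by field; lra.
by rewrite ler_piMr ?(ltW e0)// ler_pdivrMr ?ltr_wpDl// mul1r lerDl.
Qed.

Theorem mainTheorem16 (R : realType) :
  exists c : R, 0 < c /\
  forall (P : probability Omega_inf R), uniform_product P ->
  forall f : Omega_inf -> R,
    measurable_fun setT f ->
    (forall w, f w = 1 \/ f w = -1) ->
    let delta := sup (range (influence P f)) in
    0 < delta ->
    (c%:E * 'V_P[f] * (ln (delta^-1))%:E
       <= \sum_(0 <= k <oo) (influence P f k)%:E)%E.
Proof.
exists 20^-1; split; first by rewrite invr_gt0.
move=> P uP f mf f1 delta d0; set A := [set w | f w = 1].
have mA : measurable A.
  by have := mf measurableT _ (measurable_set1 1); rewrite setTI.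
have mY k : measurable (A `+` flip k @^-1` A).
  by apply: measurable_setY => //; exact: measurable_preimage_flip.
have le1 k : influence P f k <= 1.
  rewrite influence_sgn// -[leRHS](prT P).
  exact: pr_le (mY k) measurableT (@subsetT _ _).
have d1 : delta <= 1.
  by apply: ge_sup => [|_ [k _ <-]//]; exists (influence P f 0), 0%N.
have Ad k : pr P (A `+` flip k @^-1` A) <= delta.
  rewrite -influence_sgn//; apply: ub_le_sup; last by exists k.
  by exists 1 => _ [j _ <-].
rewrite (variance_sgn P mf f1) -/A -!EFinM.
(* With slack [e], a partial sum of the influences suffices, and it is below the series even if that
   diverges. *)
apply/lee_addgt0Pr => e e0.
have e20 : 0 < 20 * e by rewrite mulr_gt0.
have d01 : 0 < delta <= 1 by rewrite d0.
have [n nP] := variance_ln_le uP mA d01 Ad e20.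
apply: (@le_trans _ _ ((\sum_(0 <= k < n) influence P f k)%:E + e%:E)%E).
  rewrite -EFinD lee_fin -mulrA -ler_pdivlMl ?invr_gt0// invrK mulrDr.
  by under eq_bigr do rewrite influence_sgn//.
rewrite leeD2r// -sumEFin; apply: nneseries_lim_ge => k _ _.
by rewrite lee_fin influence_sgn// pr_ge0.
Qed.
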